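(* Let $\mu$ be an irreducible, finitely supported, symmetric probability measure on $\mathrm{Homeo}^+(\mathbf{R})$. Then there exists a compact interval $K\subset\mathbf{R}$ such that, for every $x\in\mathbf{R}$, almost surely the sequence $(X_n^x)_{n\ge 0}$ belongs to $K$ for infinitely many $n$.
   Context: $\mathrm{Homeo}^+(\mathbf{R})$ is the group of orientation-preserving (increasing) homeomorphisms of the real line, and $G$ denotes the group generated by the support of $\mu$. The measure $\mu$ is symmetric if $\mu(g)=\mu(g^{-1})$ for all $g$, and irreducible if $G$ has no global fixed point, i.e. for every $x\in\mathbf{R}$ there is $g\in G$ with $g(x)\neq x$. Let $g_1,g_2,\dots$ be i.i.d. random homeomorphisms with distribution $\mu$, and set $f_n=g_n\circ\cdots\circ g_1$ and $X_n^x=f_n(x)$ (with $X_0^x=x$). *)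

(* Defs.v *)
From HB Require Import structures.
From mathcomp Require Import all_boot all_order all_algebra finmap.
From mathcomp Require Import all_classical all_reals all_analysis.
Set Implicit Arguments.
Unset Strict Implicit.
Unset Printing Implicit Defensive.
Import Order.TTheory GRing.Theory Num.Theory.
Import numFieldNormedType.Exports.
Local Open Scope classical_set_scope.
Local Open Scope ring_scope.

(* Homeo^+(R); the inverse is carried along, see [homeo_eq] for equality. *)
Record homeo (R : realType) := Homeo {
  homeo_fun :> R -> R;
  homeo_inv : R -> R;
  homeo_incr : {homo homeo_fun : x y / x < y};
  homeo_continuous : continuous homeo_fun;
  homeo_inv_continuous : continuous homeo_inv;
  homeoK : cancel homeo_fun homeo_inv;
  homeoVK : cancel homeo_inv homeo_fun
}.

Section homeo_group.
Variable R : realType.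
Implicit Types g h : homeo R.

Lemma homeo_eq g h : homeo_fun g = homeo_fun h -> g = h.
Proof.
case: g h => [f u fi fc uc fK uK] [f' v gi gc vc gK vK] /= ff'.
have uv : u = v.
  by apply/funext => x; rewrite -{1}(vK x) -ff' fK.
by subst f' v; congr Homeo; exact: Prop_irrelevance.
Qed.

Lemma homeo_inv_incr g : {homo homeo_inv g : x y / x < y}.
Proof.
move=> x y xy; rewrite ltNge; apply/negP; rewrite le_eqVlt => /orP[/eqP e|].
  by move: xy; rewrite -(homeoVK g x) -(homeoVK g y) e ltxx.
by move/(homeo_incr g); rewrite !homeoVK => /(lt_trans xy); rewrite ltxx.
Qed.

Definition homeo_one : homeo R :=
  @Homeo R id id (fun _ _ xy => xy) (fun _ => cvg_id) (fun _ => cvg_id)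
    (fun _ => erefl) (fun _ => erefl).

Definition homeo_inverse g : homeo R :=
  @Homeo R (homeo_inv g) g (@homeo_inv_incr g) (@homeo_inv_continuous R g)
    (@homeo_continuous R g) (@homeoVK R g) (@homeoK R g).

Lemma homeo_comp_incr g h : {homo g \o h : x y / x < y}.
Proof. by move=> x y /(homeo_incr h)/(homeo_incr g). Qed.

Lemma homeo_comp_continuous g h : continuous (g \o h).
Proof. by move=> x; apply: continuous_comp; exact: homeo_continuous. Qed.

Lemma homeo_comp_inv_continuous g h : continuous (homeo_inv h \o homeo_inv g).
Proof. by move=> x; apply: continuous_comp; exact: homeo_inv_continuous. Qed.

Definition homeo_comp g h : homeo R :=
  @Homeo R (g \o h) (homeo_inv h \o homeo_inv g) (@homeo_comp_incr g h)
    (@homeo_comp_continuous g h) (@homeo_comp_inv_continuous g h)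
    (can_comp (@homeoK R g) (@homeoK R h))
    (can_comp (@homeoVK R h) (@homeoVK R g)).

HB.instance Definition _ := gen_eqMixin (homeo R).
HB.instance Definition _ := gen_choiceMixin (homeo R).
HB.instance Definition _ := isPointed.Build (homeo R) homeo_one.

Lemma homeo_compA : associative homeo_comp.
Proof. by move=> g h k; exact: homeo_eq. Qed.

Lemma homeo_comp1g : left_id homeo_one homeo_comp.
Proof. by move=> g; exact: homeo_eq. Qed.

Lemma homeo_compg1 : right_id homeo_one homeo_comp.
Proof. by move=> g; exact: homeo_eq. Qed.

Lemma homeo_compVg : left_inverse homeo_one homeo_inverse homeo_comp.
Proof. by move=> g; apply/homeo_eq/funext => x /=; rewrite homeoK. Qed.

Lemma homeo_compgV : right_inverse homeo_one homeo_inverse homeo_comp.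
Proof. by move=> g; apply/homeo_eq/funext => x /=; rewrite homeoVK. Qed.

HB.instance Definition _ := isGroup.Build (homeo R)
  homeo_compA homeo_comp1g homeo_compg1 homeo_compVg homeo_compgV.

End homeo_group.

(* The cylinders generate the sigma-algebra of the evaluation maps g |-> g x,
   which is the Borel sigma-algebra of Homeo^+(R) for the compact-open topology
   (on Homeo^+(R) it coincides with the topology of pointwise convergence). *)
Definition homeo_cylinders (R : realType) : set (set (homeo R)) :=
  [set C | exists x (A : set R), measurable A /\ C = [set g : homeo R | A (g x)]].

HB.instance Definition _ (R : realType) := Measurable.copy (homeo R)
  (g_sigma_algebraType (@homeo_cylinders R)).

Section homeo_measurable.
Variable R : realType.

Lemma measurable_homeo_eval (x : R) :
  measurable_fun [set: homeo R] (fun g : homeo R => g x).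
Proof.
by move=> _ A mA; rewrite setTI; apply: sub_sigma_algebra; exists x, A.
Qed.

Lemma measurable_homeo1 (g : homeo R) : measurable [set g].
Proof.
have -> : [set g] = \bigcap_(q : rat) [set h : homeo R | h (ratr q) = g (ratr q)].
  apply/seteqP; split => [h -> //|h hg]; apply/homeo_eq/funext => x.
  apply/eqP; apply: contrapT => /negP; rewrite neq_lt.
  wlog hgx : g h hg / h x < g x.
    by move=> W /orP[lt|lt]; [apply: (W g h)|apply: (W h g)] => //;
      rewrite ?lt// => q _; rewrite /= hg.
  move=> _; pose y := homeo_inv h (g x).
  have xy : x < y by rewrite -(homeoK h x); exact: homeo_inv_incr.
  have [q] := rat_in_itvoo xy; rewrite in_itv/= => /andP[xq qy].
  have := homeo_incr g xq; rewrite -hg// => gh.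
  have := homeo_incr h qy; rewrite /y homeoVK => hg'.
  by have := lt_trans gh hg'; rewrite ltxx.
rewrite -[X in measurable X]setCK setC_bigcap; apply: measurableC.
apply: bigcupT_measurable_rat => q; apply: measurableC.
by have := @measurable_homeo_eval (ratr q) measurableT [set g (ratr q)]
  (measurable_set1 _); rewrite setTI.
Qed.

End homeo_measurable.

Section finitely_supported_measures.
Variables (R : realType) (mu : probability (homeo R) R).

Definition finitely_supported := exists2 F, finite_set F & mu F = 1%E.

(* For a finitely supported measure the support is the set of atoms. *)
Definition measure_support := [set g | (0 < mu [set g])%E].

Definition symmetric_measure := forall g, mu [set g] = mu [set g^-1%g].

Definition generated_group : set (homeo R) :=
  smallest (fun H : set (homeo R) => group_closed (mem H)) measure_support.

Definition irreducible_measure := forall x : R, exists2 g, generated_group g & g x <> x.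

End finitely_supported_measures.

Section random_walk.
Context {d : measure_display} {R : realType} {Omega : measurableType d}.
Variables (P : probability Omega R) (g : nat -> {RV P >-> homeo R}).

Definition mutually_independent :=
  forall (J : {fset nat}) (A : nat -> set (homeo R)),
    (forall i, measurable (A i)) ->
    P (\bigcap_(i in [set` J]) g i @^-1` A i)
      = (\prod_(i <- J) P (g i @^-1` A i))%E.

Definition iid (mu : probability (homeo R) R) :=
  mutually_independent /\
  forall i A, measurable A -> distribution P (g i) A = mu A.

(* The sequence is indexed from 0: [g n] is the (n+1)-st increment. *)
Fixpoint random_product (n : nat) (w : Omega) : homeo R :=
  if n is n'.+1 then (g n' w * random_product n' w)%g else 1%g.

Definition walk (x : R) (n : nat) (w : Omega) : R := random_product n w x.

End random_walk.

(* Main.v *)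
(* Write T for the Markov operator (T phi)(x) = sum_h mu(h) phi(h x), and let
   u(x) be the probability that the walk started at x stays above b forever.
   Then u = 1_{>b} T u, so T^n u increases with n. Given x, irreducibility
   provides a word h with h(x) <= b; running h and then its inverse, a walk
   started at z <= x gets killed at b and comes back to z, so that for some k
   and c > 0, T^k u - u >= c u on (-oo, x]. As T^n (T^k u - u) tends to 0,
     u(x) <= T^n u(x) <= P(f_n(x) > x) + o(1) <= 1/2 + o(1),
   the last step because f_n and its inverse have the same law. Finally u <= 1/2
   together with u = 1_{>b} T u gives u <= P(X_0, ..., X_n > b) / 2 for all n,
   hence u <= u / 2 and u = 0. By reflection the walk does not stay below a
   forever either. With [a, b] the hull of 0 and of the h(0), h in the support,
   the walk cannot jump over [a, b], and thus visits it infinitely often. *)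
Require Import Defs.
From HB Require Import structures.
From mathcomp Require Import all_boot all_order all_algebra finmap.
From mathcomp Require Import all_classical all_reals all_analysis.
From mathcomp Require Import lra.
Set Implicit Arguments.
Unset Strict Implicit.
Unset Printing Implicit Defensive.
Import Order.TTheory GRing.Theory Num.Theory.
Import numFieldNormedType.Exports.
Local Open Scope classical_set_scope.
Local Open Scope ring_scope.

(** * The Markov operator of a finite weighted family of maps *)

Section averaging.
Context {R : realType} {I : eqType}.
Variables (S : seq I) (w : I -> R) (f : I -> R -> R).

Definition avg (phi : R -> R) (x : R) : R := \sum_(i <- S) w i * phi (f i x).

(* [stay A n x] is the probability that X_0, ..., X_n all lie in [A], for the
   walk started at [x]. *)
Definition stay (A : pred R) (n : nat) : R -> R :=
  iter n (fun phi x => (A x)%:R * avg phi x) (fun x => (A x)%:R).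

Lemma eq_avg (phi psi : R -> R) : phi =1 psi -> avg phi =1 avg psi.
Proof. by move=> e x; apply: eq_bigr => i _; rewrite e. Qed.

Lemma avgB (phi psi : R -> R) x :
  avg (fun y => phi y - psi y) x = avg phi x - avg psi x.
Proof.
by rewrite /avg -sumrB; apply: eq_bigr => i _; rewrite mulrBr.
Qed.

Lemma avgD (phi psi : R -> R) x :
  avg (fun y => phi y + psi y) x = avg phi x + avg psi x.
Proof.
by rewrite /avg -big_split; apply: eq_bigr => i _; rewrite mulrDr.
Qed.

Lemma avgZ c (phi : R -> R) x : avg (fun y => c * phi y) x = c * avg phi x.
Proof. by rewrite /avg mulr_sumr; apply: eq_bigr => i _; rewrite mulrCA. Qed.

Lemma iter_avgB n (phi psi : R -> R) x :
  iter n avg (fun y => phi y - psi y) x = iter n avg phi x - iter n avg psi x.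
Proof.
elim: n x => [//|n IH] x /=; rewrite -avgB; exact: eq_avg.
Qed.

Lemma iter_avgD n (phi psi : R -> R) x :
  iter n avg (fun y => phi y + psi y) x = iter n avg phi x + iter n avg psi x.
Proof.
elim: n x => [//|n IH] x /=; rewrite -avgD; exact: eq_avg.
Qed.

Lemma iter_avgZ n c (phi : R -> R) x :
  iter n avg (fun y => c * phi y) x = c * iter n avg phi x.
Proof.
elim: n x => [//|n IH] x /=; rewrite -avgZ; exact: eq_avg.
Qed.

Lemma cvg_avg (phi_ : nat -> R -> R) (phi : R -> R) :
  (forall x, phi_ n x @[n --> \oo] --> phi x) ->
  forall x, avg (phi_ n) x @[n --> \oo] --> avg phi x.
Proof.
move=> cphi x; rewrite /avg; elim: S => [|i s IH].
  by rewrite big_nil; under eq_fun do rewrite big_nil; exact: cvg_cst.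
rewrite big_cons; under eq_fun do rewrite big_cons.
by apply: cvgD => //; apply: cvgMr.
Qed.

Lemma cvg_iter_avg (phi_ : nat -> R -> R) (phi : R -> R) m :
  (forall x, phi_ n x @[n --> \oo] --> phi x) ->
  forall x, iter m avg (phi_ n) x @[n --> \oo] --> iter m avg phi x.
Proof. by move=> cphi; elim: m => [//|m IH]; exact: cvg_avg. Qed.

End averaging.

(** Kept abstract, instead of being stated for homeomorphisms in the support, so that it applies
    equally to the maps conjugated by [x |-> -x]. *)
Record symmetric_system {R : realType} {I : eqType}
    (S : seq I) (w : I -> R) (f : I -> R -> R) (inv : I -> I) : Prop := {
  weight_gt0 : forall i, i \in S -> 0 < w i;
  weight_sum : \sum_(i <- S) w i = 1;
  weight_inv : forall i, w (inv i) = w i;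
  mem_inv : forall i, i \in S -> inv i \in S;
  sum_inv : forall F : I -> R,
    \sum_(i <- S) w i * F (inv i) = \sum_(i <- S) w i * F i;
  map_incr : forall i, {homo f i : x y / x < y};
  mapK : forall i, cancel (f i) (f (inv i));
  mapVK : forall i, cancel (f (inv i)) (f i);
  no_common_fixpoint : forall x, exists2 i, i \in S & f i x != x }.

(** * Duality and communication for a symmetric walk *)

Section symmetric_walk.
Context {R : realType} {I : eqType}.
Variables (S : seq I) (w : I -> R) (f : I -> R -> R) (inv : I -> I).
Hypothesis sys : symmetric_system S w f inv.
Local Notation T := (avg S w f).
Local Notation stay := (stay S w f).

Lemma le_avg (phi psi : R -> R) :
  (forall x, phi x <= psi x) -> forall x, T phi x <= T psi x.
Proof.
move=> le x; rewrite /avg !big_seq; apply: ler_sum => i iS.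
by apply: ler_wpM2l => //; exact/ltW/(weight_gt0 sys).
Qed.

Lemma avg_cst c x : T (fun=> c) x = c.
Proof. by rewrite /avg -mulr_suml (weight_sum sys) mul1r. Qed.

Lemma le_iter_avg n (phi psi : R -> R) :
  (forall x, phi x <= psi x) -> forall x, iter n T phi x <= iter n T psi x.
Proof. by move=> le; elim: n => [//|n IH]; exact: le_avg. Qed.

Lemma iter_avg_cst n c x : iter n T (fun=> c) x = c.
Proof. by elim: n x => [//|n IH] x /=; rewrite (eq_avg _ _ _ IH) avg_cst. Qed.

Lemma iter_avg_ge0 n (phi : R -> R) :
  (forall x, 0 <= phi x) -> forall x, 0 <= iter n T phi x.
Proof. by move=> h x; rewrite -[leLHS](iter_avg_cst n 0 x); exact: le_iter_avg. Qed.

Lemma iter_avg_le1 n (phi : R -> R) :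
  (forall x, phi x <= 1) -> forall x, iter n T phi x <= 1.
Proof. by move=> h x; rewrite -[leRHS](iter_avg_cst n 1 x); exact: le_iter_avg. Qed.

Lemma avg_ge_term i (phi : R -> R) x :
  i \in S -> (forall y, 0 <= phi y) -> w i * phi (f i x) <= T phi x.
Proof.
move=> iS h; rewrite /avg (big_rem i iS) /= lerDl big_seq sumr_ge0// => j jS.
by rewrite mulr_ge0//; exact/ltW/(weight_gt0 sys)/(mem_rem jS).
Qed.

Lemma map_le i : {homo f i : x y / x <= y}.
Proof.
move=> x y; rewrite le_eqVlt => /orP[/eqP-> //|xy].
exact/ltW/(map_incr sys).
Qed.

Lemma map_lt_inv i x y : (y < f i x) = (f (inv i) y < x).
Proof.
apply/idP/idP => /(map_incr sys).
  by move=> /(_ (inv i)); rewrite (mapK sys).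
by move=> /(_ i); rewrite (mapVK sys).
Qed.

(* [f_n] and its inverse have the same law. *)
Lemma avg_duality n (x y : R) :
  iter n T (fun z => (y < z)%R%:R) x = iter n T (fun z => (z < x)%R%:R) y.
Proof.
elim: n x y => [//|n IH] x y; rewrite iterSr.
(* The last increment is moved across the inequality, where its inverse acts on [y]; [sum_inv] then
   removes the inverse. *)
have -> : iter n T (T (fun z => (y < z)%R%:R)) x =
    \sum_(i <- S) w i * iter n T (fun z => (f (inv i) y < z)%R%:R) x.
  elim: n {IH} x => [|n IH] x /=; first by apply: eq_bigr => i _; rewrite map_lt_inv.
  rewrite (eq_avg _ _ _ IH) /avg.
  under eq_bigr do rewrite mulr_sumr.
  rewrite exchange_big; apply: eq_bigr => i _; rewrite mulr_sumr.
  by apply: eq_bigr => j _; rewrite mulrCA.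
rewrite (sum_inv sys (fun i => iter n T (fun z => (f i y < z)%R%:R) x)).
by apply: eq_bigr => i _; rewrite IH.
Qed.

(** Ending above and ending below [x] are disjoint events, and duality at [y = x] gives them equal
    probability. *)
Lemma avg_above_le_half n (x : R) : iter n T (fun z => (x < z)%R%:R) x <= 2^-1.
Proof.
have : iter n T (fun z => (x < z)%R%:R + (z < x)%R%:R) x <= 1.
  by apply: iter_avg_le1 => z; case: ltgtP; rewrite ?addr0 ?add0r ?ler01.
rewrite iter_avgD -avg_duality; lra.
Qed.

(* Abstracts a word [h] in the maps, run forwards or backwards. *)
Definition communicates (h : R -> R) := {homo h : x y / x <= y} /\
  exists n e, 0 < e /\ forall phi : R -> R, (forall y, 0 <= phi y) -> forall z,
    e * phi (h z) <= iter n T phi z /\ e * phi z <= iter n T phi (h z).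

Lemma communicates_id : communicates id.
Proof. by split=> //; exists 0%N, 1; split=> // phi _ z; rewrite mul1r. Qed.

Lemma communicates_comp i h :
  i \in S -> communicates h -> communicates (f i \o h).
Proof.
move=> iS [hh [n [e [e0 he]]]]; split; first by move=> x y /hh; exact: map_le.
have wi0 := weight_gt0 sys iS.
exists n.+1, (e * w i); split; first exact: mulr_gt0.
move=> phi phi0 z; split.
  rewrite iterSr; apply: le_trans (proj1 (he _ _ z)).
    by rewrite -mulrA ler_pM2l //=; exact: avg_ge_term.
  exact: (iter_avg_ge0 1).
(* The way back undoes [f i] first: one step of weight [w (inv i) = w i], then the [n] steps from
   [h z]. *)
rewrite iterS; have := avg_ge_term (f i (h z))
  (mem_inv sys iS) (iter_avg_ge0 n phi0).
rewrite (weight_inv sys) (mapK sys); apply: le_trans.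
rewrite mulrAC mulrC ler_pM2l //; exact: (proj2 (he _ phi0 z)).
Qed.

(* Otherwise the infimum of the orbit of [x] is a common fixed point. *)
Lemma exists_communicates_le x b : exists2 h, communicates h & h x <= b.
Proof.
apply: contrapT => no.
pose O := [set h x | h in communicates].
have lbO : has_lbound O.
  exists b => _ [h ch <-]; rewrite leNgt; apply/negP => /ltW hb.
  by apply: no; exists h.
have O0 : O !=set0 by exists x, id => //; exact: communicates_id.
have le_map i : i \in S -> inf O <= f i (inf O).
  move=> iS; rewrite -[leRHS](mapVK sys i) -{1}(mapVK sys i (inf O)).
  apply: map_le; rewrite (mapK sys); apply: lb_le_inf => // _ [h ch <-].
  rewrite -(mapK sys i (h x)); apply: map_le.
  apply: ge_inf => //; exists (f i \o h) => //; exact: communicates_comp.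
have [i iS /eqP[]] := no_common_fixpoint sys (inf O).
(* The reverse inequality is [le_map] for [inv i], pushed forward by [f i]. *)
apply/eqP; rewrite eq_le le_map// andbT.
rewrite -[leRHS](mapVK sys i); apply: map_le.
exact/le_map/(mem_inv sys).
Qed.

(** * The probability of staying above [b] forever *)

Section survival.
Variable b : R.
Local Notation A := [pred z : R | b < z].

Lemma stay_ge0 n z : 0 <= stay A n z.
Proof.
elim: n z => [|n IH] z /=; first exact: ler0n.
by rewrite mulr_ge0//; exact: (iter_avg_ge0 1).
Qed.

Lemma stay_le1 n z : stay A n z <= 1.
Proof.
elim: n z => [|n IH] z /=; first by case: (b < z); rewrite ?lexx ?ler01.
by rewrite mulr_ile1 ?ler0n ?(iter_avg_ge0 1) ?(iter_avg_le1 1)//;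
  [exact: stay_ge0|case: (b < z); rewrite ?lexx ?ler01].
Qed.

Lemma stay_nonincreasing z : nonincreasing_seq (stay A ^~ z).
Proof.
apply/nonincreasing_seqP => n; elim: n z => [|n IH] z /=.
  rewrite ler_piMr ?ler0n//; apply: (iter_avg_le1 1) => y.
  exact: (stay_le1 0).
by rewrite ler_wpM2l ?ler0n//; exact: le_avg.
Qed.

Definition survival z := limn (stay A ^~ z).

Lemma is_cvg_stay z : cvgn (stay A ^~ z).
Proof.
apply: nonincreasing_is_cvgn; first exact: stay_nonincreasing.
by exists 0 => _ [n _ <-]; exact: stay_ge0.
Qed.

Lemma cvg_stay z : stay A n z @[n --> \oo] --> survival z.
Proof. exact: is_cvg_stay. Qed.

Lemma survival_le_stay n z : survival z <= stay A n z.
Proof. exact: (nonincreasing_cvgn_ge (@stay_nonincreasing z) (@is_cvg_stay z) n). Qed.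

Lemma survival_ge0 z : 0 <= survival z.
Proof. by apply: limr_ge; [exact: is_cvg_stay|apply: nearW => n; exact: stay_ge0]. Qed.

(** The limit of the recursion that defines [stay]: [T] is a finite sum, hence commutes with
    pointwise limits. *)
Lemma survivalE z : survival z = (b < z)%R%:R * T survival z.
Proof.
have h1 : stay A n.+1 z @[n --> \oo] --> survival z.
  by have := @cvg_stay z; rewrite -(cvg_shiftS (stay A ^~ z)).
have h2 : stay A n.+1 z @[n --> \oo] --> (b < z)%R%:R * T survival z.
  by apply: cvgMr; apply: cvg_avg => x; exact: cvg_stay.
exact: (cvg_unique _ h1 h2).
Qed.

Lemma survival_le_avg z : survival z <= T survival z.
Proof.
rewrite survivalE; apply: ler_piMl; last by case: (b < z); rewrite ?lexx ?ler01.
by apply: (iter_avg_ge0 1); exact: survival_ge0.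
Qed.

Lemma survival_le_iter n z : survival z <= iter n T survival z.
Proof.
elim: n z => [//|n IH] z; apply: (le_trans (survival_le_avg z)).
exact: le_avg.
Qed.

Lemma iter_survival_nondecreasing z : nondecreasing_seq (fun n => iter n T survival z).
Proof.
apply/nondecreasing_seqP => n; rewrite iterSr; apply: le_iter_avg.
exact: survival_le_avg.
Qed.

(* A walk started below [c] may go below [b], hence die, and come back to its
   starting point: this makes [survival] strictly subharmonic there. *)
Lemma survival_gap c : exists k e, 0 < e /\
  forall z, e * (survival z * (z <= c)%R%:R) <= iter k T survival z - survival z.
Proof.
have [h [hh [n [e [e0 he]]]] hcb] := exists_communicates_le c b.
exists (n + n)%N, (e * e); split; first exact: mulr_gt0.
move=> z; have [zc|zc] := leP z c; last first.
  by rewrite mulr0 mulr0 subr_ge0; exact: survival_le_iter.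
rewrite mulr1.
have s0 : survival (h z) = 0.
  by rewrite survivalE ltNge (le_trans (hh _ _ zc) hcb) mul0r.
have gap_ge0 y : 0 <= iter n T survival y - survival y.
  by rewrite subr_ge0; exact: survival_le_iter.
(* At [h z], where [survival] vanishes, the gap over [n] steps is all of [iter n T survival], which
   the way back bounds below by [e * survival z]. The way there costs the second factor [e]. *)
have := proj1 (he _ gap_ge0 z); rewrite iter_avgB -iterD s0 subr0 => h1.
have h2 := proj2 (he _ survival_ge0 z).
have h3 := survival_le_iter n z.
have h4 : e * e * survival z <= e * iter n T survival (h z).
  by rewrite -mulrA ler_pM2l.
lra.
Qed.

Lemma survival_le_half x : survival x <= 2^-1.
Proof.
have [k [e [e0 gap]]] := survival_gap x.
pose v n := iter n T survival x.
have cv : cvgn v.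
  apply: nondecreasing_is_cvgn; first exact: iter_survival_nondecreasing.
  exists 1 => _ [n _ <-]; apply: iter_avg_le1 => y.
  by apply: le_trans (survival_le_stay 0 y) _; exact: stay_le1.
(* Since [v] is monotone and bounded, its increments over [k] steps vanish. It remains to bound
   [survival x] by this expression for every [n]. *)
have cgap : e^-1 * (v (n + k)%N - v n) + 2^-1 @[n --> \oo] --> (2^-1 : R).
  rewrite -[X in _ --> X]add0r; apply: cvgD; last exact: cvg_cst.
  rewrite -(mulr0 e^-1); apply: cvgMr; rewrite -(subrr (limn v)).
  by apply: cvgB => //; rewrite (cvg_shiftn k v).
rewrite -(cvg_lim _ cgap)//; apply: limr_ge; first by apply/cvg_ex; eexists; exact: cgap.
apply: nearW => n; apply: (le_trans (survival_le_iter n x)).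
(* Split by the position at time [n]: up to [x] the gap inequality applies, above [x] survival is at
   most 1. *)
apply: (@le_trans _ _ (iter n T (fun z => survival z * (z <= x)%R%:R +
    (x < z)%R%:R) x)).
  apply: le_iter_avg => z; case: (leP z x) => _; first by rewrite mulr1 addr0.
  rewrite mulr0 add0r; apply: le_trans (survival_le_stay 0 z) _; exact: stay_le1.
rewrite iter_avgD lerD//; last exact: avg_above_le_half.
rewrite -(ler_pM2l e0) mulrA divff ?gt_eqF// mul1r -iter_avgZ.
apply: (le_trans (le_iter_avg n gap x)).
by rewrite iter_avgB -iterD.
Qed.

Lemma survival_eq0 z : survival z = 0.
Proof.
have le n y : survival y <= 2^-1 * stay A n y.
  elim: n y => [|n IH] y /=; rewrite survivalE.
    have [by_|yb] /= := ltP b y; last by rewrite mul0r mulr0.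
    rewrite mulr1 mul1r; have := survivalE y; rewrite by_ mul1r => <-; exact: survival_le_half.
  by rewrite mulrCA ler_wpM2l ?ler0n// -avgZ; exact: le_avg.
have : survival z <= 2^-1 * survival z.
  have c : 2^-1 * stay A n z @[n --> \oo] --> 2^-1 * survival z.
    by apply: cvgMr; exact: cvg_stay.
  rewrite -[leRHS](cvg_lim _ c)//; apply: limr_ge.
    by apply/cvg_ex; eexists; exact: c.
  by apply: nearW => n; exact: le.
have := survival_ge0 z; lra.
Qed.

(** The [m] unconstrained steps in front serve to exclude staying above [b] from any later time on,
    not only from time 0. *)
Lemma cvg_iter_stay_above m x : iter m T (stay A n) x @[n --> \oo] --> 0.
Proof.
rewrite -(iter_avg_cst m 0 x); apply: cvg_iter_avg => y.
by rewrite -(survival_eq0 y); exact: cvg_stay.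
Qed.

End survival.
End symmetric_walk.

(** * Conjugation by [x |-> -x], which exchanges above and below *)

Section reflection.
Context {R : realType} {I : eqType}.
Variables (S : seq I) (w : I -> R) (f : I -> R -> R) (inv : I -> I).

Definition reflected (i : I) (x : R) : R := - f i (- x).

Lemma symmetric_system_reflected :
  symmetric_system S w f inv -> symmetric_system S w reflected inv.
Proof.
case=> w0 w1 wV SV sV fi fK fVK nofix; split=> //.
- by move=> i x y xy; rewrite /reflected ltrN2; apply: fi; rewrite ltrN2.
- by move=> i x; rewrite /reflected opprK fK opprK.
- by move=> i x; rewrite /reflected opprK fVK opprK.
- move=> x; have [i iS ix] := nofix (- x); exists i => //.
  by rewrite /reflected eqr_oppLR.
Qed.

Lemma avg_reflected (phi psi : R -> R) :
  (forall x, phi x = psi (- x)) ->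
  forall x, avg S w f phi x = avg S w reflected psi (- x).
Proof.
by move=> e x; apply: eq_bigr => i _; rewrite e /reflected opprK.
Qed.

Lemma stay_reflected (a : R) n x :
  stay S w f [pred z : R | z < a] n x =
  stay S w reflected [pred z : R | - a < z] n (- x).
Proof.
elim: n x => [|n IH] x /=; rewrite ltrN2 //.
by congr (_ * _); exact: avg_reflected.
Qed.

Lemma cvg_iter_stay_below (a : R) m x : symmetric_system S w f inv ->
  iter m (avg S w f) (stay S w f [pred z : R | z < a] n) x @[n --> \oo] --> 0.
Proof.
move=> /symmetric_system_reflected sys.
have e n : iter m (avg S w f) (stay S w f [pred z : R | z < a] n) x =
    iter m (avg S w reflected) (stay S w reflected [pred z : R | - a < z] n) (- x).
  elim: m x => [|m IH] x; first exact: stay_reflected.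
  by rewrite !iterS; apply: avg_reflected.
under eq_fun do rewrite e.
exact: (cvg_iter_stay_above sys).
Qed.

End reflection.

(** * Bounds on outer measure *)

Section outer_bound.
Context {d : measure_display} {R : realType} {Omega : measurableType d}.
Variable P : probability Omega R.

(* An upper bound on the outer measure: [E] need not be measurable, so that no
   measurability of the walk is ever required. *)
Definition outer_le (E : set Omega) (r : R) :=
  exists B, [/\ measurable B, E `<=` B & (P B <= r%:E)%E].

Lemma outer_leS E E' r : E `<=` E' -> outer_le E' r -> outer_le E r.
Proof. by move=> EE' [B [mB EB PB]]; exists B; split=> //; exact: subset_trans EB. Qed.

Lemma outer_le0 : outer_le set0 0.
Proof. by exists set0; split=> //; rewrite measure0. Qed.

Lemma outer_leU E E' r r' :
  outer_le E r -> outer_le E' r' -> outer_le (E `|` E') (r + r').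
Proof.
move=> [B [mB EB PB]] [B' [mB' EB' PB']]; exists (B `|` B'); split.
- exact: measurableU.
- exact: setUSS.
- by rewrite EFinD; apply: le_trans (measureU2 _ mB mB') _; exact: leeD.
Qed.

Lemma outer_le_bigU (I : eqType) (s : seq I) (E : I -> set Omega) (r : I -> R) :
  (forall i, i \in s -> outer_le (E i) (r i)) ->
  outer_le [set w | exists2 i, i \in s & E i w] (\sum_(i <- s) r i).
Proof.
elim: s => [|i s IH] h.
  by rewrite big_nil; apply: outer_leS outer_le0 => w [].
rewrite big_cons; apply: (@outer_leS _ (E i `|` [set w | exists2 j, j \in s & E j w])).
  move=> w [j]; rewrite inE => /predU1P[-> //|js] Ej; first by left.
  by right; exists j.
apply: outer_leU; first by apply: h; exact: mem_head.
by apply: IH => j js; apply: h; rewrite inE js orbT.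
Qed.

(** The intersection of measurable covers chosen for all [n] is a single null set containing [E]. *)
Lemma negligible_outer_le E (r : nat -> R) :
  (forall n, outer_le E (r n)) -> r n @[n --> \oo] --> 0 -> P.-negligible E.
Proof.
move=> h r0; pose B n := sval (cid (h n)).
have hB n : [/\ measurable (B n), E `<=` B n & (P (B n) <= (r n)%:E)%E].
  exact: (svalP (cid (h n))).
exists (\bigcap_n B n); split.
- by apply: bigcapT_measurable => n; have [] := hB n.
- apply/eqP; rewrite -measure_le0.
  have mB : measurable (\bigcap_n B n).
    by apply: bigcapT_measurable => n; have [] := hB n.
  have Pf := fin_num_measure P _ mB; rewrite -(fineK Pf) lee_fin.
  rewrite -(cvg_lim _ r0)//; apply: limr_ge; first by apply/cvg_ex; exists 0.
  apply: nearW => n; have [mBn _ PB] := hB n.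
  rewrite -lee_fin fineK//; apply: le_trans PB.
  by apply: le_measure; rewrite ?inE//; exact: bigcap_inf.
- by move=> x Ex n _; have [_ + _] := hB n; exact.
Qed.

End outer_bound.

(** * The support of [mu] as a symmetric system *)

Section atoms.
Context {R : realType} (mu : probability (homeo R) R).

Definition atom_weight (h : homeo R) : R := fine (mu [set h]).

Lemma atom_weightE h : mu [set h] = (atom_weight h)%:E.
Proof. by rewrite /atom_weight fineK// fin_num_measure//; exact: measurable_homeo1. Qed.

Lemma finite_measurable_homeo (F : set (homeo R)) : finite_set F -> measurable F.
Proof.
move=> fF; rewrite -(image_id F) -bigcup_imset1.
by apply: fin_bigcup_measurable => // h _; exact: measurable_homeo1.
Qed.

Lemma finite_mass (F : set (homeo R)) :
  finite_set F -> mu F = (\sum_(h \in F) mu [set h])%E.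
Proof.
move=> fF; rewrite -{1}(image_id F) -bigcup_imset1 measure_fin_bigcup //.
- by move=> h h' _ _ [k [/= -> ->]].
- by move=> k _; exact: measurable_homeo1.
Qed.

Hypothesis mu_fin : finitely_supported mu.

(** A finite set of mass 1 has a null complement, so it contains every atom; its other points have
    mass 0 and drop out of the sum. *)
Lemma finite_support : finite_set (measure_support mu) /\ mu (measure_support mu) = 1%E.
Proof.
have [F fF F1] := mu_fin.
have mF := finite_measurable_homeo fF.
have sub : measure_support mu `<=` F.
  move=> h; apply: contraPP => Fh; rewrite /measure_support /= => /lt_geF/negP[].
  have : mu (~` F) = 0%E by rewrite probability_setC// F1 subee.
  move=> <-; apply: le_measure; rewrite ?inE.
  - exact: measurable_homeo1.
  - exact: measurableC.
  - by move=> _ ->.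
have fS := sub_finite_set sub fF; split=> //.
rewrite finite_mass// -F1 (finite_mass fF); apply: fsbig_widen => // h [_ nh].
by apply/eqP; rewrite -measure_le0 leNgt; apply/negP.
Qed.

Definition atoms : seq (homeo R) := fset_set (measure_support mu).

Lemma mem_atoms h : (h \in atoms) = (0 < mu [set h])%E.
Proof.
rewrite /atoms in_fset_set; last exact: (proj1 finite_support).
by apply/idP/idP; rewrite inE.
Qed.

Lemma measure_not_atoms : mu (~` [set` atoms]) = 0%E.
Proof.
have [fS S1] := finite_support.
have -> : [set` atoms] = measure_support mu.
  by apply/seteqP; split=> h /=; rewrite mem_atoms.
by rewrite probability_setC ?S1 ?subee//; exact: finite_measurable_homeo.
Qed.

Hypothesis mu_sym : symmetric_measure mu.
Hypothesis mu_irr : irreducible_measure mu.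

Lemma atom_weightV h : atom_weight h^-1%g = atom_weight h.
Proof. by rewrite /atom_weight -mu_sym. Qed.

Lemma mem_atomsV h : (h^-1%g \in atoms) = (h \in atoms).
Proof. by rewrite !mem_atoms -mu_sym. Qed.

(** Reindexing sums by inversion yields the field [sum_inv]. *)
Lemma perm_atomsV : perm_eq [seq h^-1%g | h <- atoms] atoms.
Proof.
apply: uniq_perm; first by rewrite map_inj_uniq ?fset_uniq//; exact: invg_inj.
  exact: fset_uniq.
move=> h; apply/mapP/idP => [[k kS ->]|hS]; first by rewrite mem_atomsV.
by exists h^-1%g; rewrite ?mem_atomsV// invgK.
Qed.

(** The stabilizer of [x] is a group; if it contained all atoms, it would contain
    [generated_group mu], against irreducibility. *)
Lemma no_atoms_fixpoint x : exists2 h, h \in atoms & h x != x.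
Proof.
apply: contrapT => no.
have fixx h : h \in atoms -> h x = x.
  by move=> hS; apply/eqP; apply: contrapT => /negP hx; apply: no; exists h.
have [h hG []] := mu_irr x.
apply: (hG [set k : homeo R | k x = x]); split; last first.
  by move=> k kS /=; apply: fixx; rewrite mem_atoms.
split; first by rewrite inE.
move=> k l; rewrite !inE /= => kx lx.
change (k (homeo_inv l x) = x).
by rewrite -{1}lx homeoK.
Qed.

Lemma symmetric_system_atoms :
  symmetric_system atoms atom_weight (@homeo_fun R) (fun h => h^-1%g).
Proof.
split.
- by move=> h; rewrite mem_atoms atom_weightE lte_fin.
- have [fS S1] := finite_support.
  apply: EFin_inj; rewrite -S1 finite_mass// fsbig_finite// -sumEFin.
  by apply: eq_bigr => h _; rewrite atom_weightE.
- exact: atom_weightV.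
- by move=> h; rewrite mem_atomsV.
- move=> F; rewrite -[RHS](perm_big _ perm_atomsV) big_map /=.
  by apply: eq_bigr => h _; rewrite atom_weightV.
- by move=> h; exact: homeo_incr.
- by move=> h; exact: homeoK.
- by move=> h; exact: homeoVK.
- exact: no_atoms_fixpoint.
Qed.

End atoms.

(** * From cylinder events to the Markov operator *)

Section cylinders.
Context {d : measure_display} {R : realType} {Omega : measurableType d}.
Variables (mu : probability (homeo R) R) (P : probability Omega R).
Variables (g : nat -> {RV P >-> homeo R}) (x : R).
Hypotheses (g_iid : iid g mu) (mu_fin : finitely_supported mu).
Local Notation S := (atoms mu).
Local Notation wt := (atom_weight mu).
Local Notation T := (avg S wt (@homeo_fun R)).

Definition cylinder (s : seq (homeo R)) : set Omega :=
  [set w | forall i, (i < size s)%N -> g i w = nth 1%g s i].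

(** The first letter acts first, in agreement with [random_product], which multiplies new increments
    on the left. *)
Definition endpoint (s : seq (homeo R)) : R := foldl (fun y h => homeo_fun h y) x s.

Lemma measurable_homeo_preimage i (A : set (homeo R)) :
  measurable A -> measurable (g i @^-1` A).
Proof. by move=> mA; rewrite -[_ @^-1` _]setTI; exact: (measurable_funP (g i)). Qed.

(** Independence, applied to the singletons of the letters at the indices below [size s]. *)
Lemma cylinder_le s : outer_le P (cylinder s) (\prod_(h <- s) wt h).
Proof.
pose A i : set (homeo R) := [set nth 1%g s i].
have mA i : measurable (A i) by exact: measurable_homeo1.
pose J := seq_fset tt (iota 0 (size s)).
have := proj1 g_iid J A mA.
have -> : (\prod_(i <- J) P (g i @^-1` A i) = (\prod_(h <- s) wt h)%:E)%E.
  rewrite (perm_big (iota 0 (size s))); last first.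
    by apply: uniq_perm; [exact: fset_uniq|exact: iota_uniq|exact: seq_fsetE].
  rewrite (big_nth 1%g) -prodEFin /index_iota subn0; apply: eq_bigr => i _.
  by rewrite -atom_weightE; exact: (proj2 g_iid i (A i) (mA i)).
move=> PE; exists (\bigcap_(i in [set` J]) g i @^-1` A i); split.
- by apply: fin_bigcap_measurable => // i _; exact: measurable_homeo_preimage.
- move=> w sw i /=; rewrite seq_fsetE mem_iota add0n /= => isz; exact: sw.
- by rewrite PE.
Qed.

Lemma negligible_not_atom n : P.-negligible (g n @^-1` (~` [set` S])).
Proof.
have mS : measurable [set` S] by apply: finite_measurable_homeo; exact: finite_seq.
exists (g n @^-1` (~` [set` S])); split=> //.
  by apply: measurable_homeo_preimage; exact: measurableC.
by have := proj2 g_iid n _ (measurableC mS); rewrite measure_not_atoms.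
Qed.

(** Total probability over the next increment, whose values outside the support form a null event of
    cost 0. *)
Lemma cylinder_split s (E : set Omega) (r : homeo R -> R) :
  (forall h, h \in S -> outer_le P (cylinder (rcons s h) `&` E) (r h)) ->
  outer_le P (cylinder s `&` E) (\sum_(h <- S) r h).
Proof.
move=> /outer_le_bigU hr; have [N [mN PN sN]] := negligible_not_atom (size s).
have oN : outer_le P (g (size s) @^-1` (~` [set` S])) 0.
  by exists N; split=> //; rewrite PN.
rewrite -[X in outer_le _ _ X]addr0; apply: outer_leS (outer_leU hr oN).
move=> w [cw Ew]; have [gS|gS] := boolP (g (size s) w \in S); last first.
  by right; apply/negP.
left; exists (g (size s) w) => //; split=> // i.
rewrite size_rcons ltnS leq_eqVlt => /predU1P[->|isz]; rewrite nth_rcons.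
  by rewrite ltnn eqxx.
by rewrite isz; exact: cw.
Qed.

Lemma walk_cylinder s w : cylinder s w -> walk g x (size s) w = endpoint s.
Proof.
elim/last_ind: s => [//|s h IH] cw.
rewrite /endpoint foldl_rcons -/(endpoint s) size_rcons.
have {1}-> : h = g (size s) w.
  by rewrite cw ?size_rcons// nth_rcons ltnn eqxx.
rewrite -IH // => i isz; rewrite cw ?size_rcons ?nth_rcons ?isz//.
exact: ltnW.
Qed.

Lemma endpoint_rcons s h : endpoint (rcons s h) = h (endpoint s).
Proof. by rewrite /endpoint foldl_rcons. Qed.

Lemma prod_rcons s h : \prod_(k <- rcons s h) wt k = \prod_(k <- s) wt k * wt h.
Proof. by rewrite -cats1 big_cat big_seq1. Qed.

(** The Markov property, word by word: conditioning on the next letter reproduces the recursion of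
    [stay] at the endpoint. *)
Lemma stay_cylinder_le (A : pred R) m s :
  outer_le P (cylinder s `&`
      [set w | forall j, (j <= m)%N -> A (walk g x (size s + j) w)])
    (\prod_(h <- s) wt h * stay S wt (@homeo_fun R) A m (endpoint s)).
Proof.
elim: m s => [|m IH] s.
  have [Az|nAz] := boolP (A (endpoint s)); last first.
    rewrite /= (negbTE nAz) mulr0; apply: outer_leS (outer_le0 P) => w [cw].
    by move=> /(_ 0%N isT); rewrite addn0 walk_cylinder// (negbTE nAz).
  by rewrite /= Az mulr1; apply: outer_leS (cylinder_le s) => w [].
have [Az|nAz] := boolP (A (endpoint s)); last first.
  rewrite /= (negbTE nAz) mul0r mulr0.
  apply: outer_leS (outer_le0 P) => w [cw].
  by move=> /(_ 0%N isT); rewrite addn0 walk_cylinder// (negbTE nAz).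
rewrite /= Az mul1r mulr_sumr; apply: cylinder_split => h hS.
rewrite mulrA -prod_rcons -endpoint_rcons; apply: outer_leS (IH (rcons s h)).
by move=> w [cw Aw]; split=> // j jm; rewrite size_rcons addSnnS; exact: Aw.
Qed.

Lemma iter_stay_cylinder_le (A : pred R) N m s :
  outer_le P (cylinder s `&`
      [set w | forall j, (j <= m)%N -> A (walk g x (size s + N + j) w)])
    (\prod_(h <- s) wt h *
     iter N T (stay S wt (@homeo_fun R) A m) (endpoint s)).
Proof.
elim: N s => [|N IH] s; first by rewrite addn0; exact: stay_cylinder_le.
rewrite iterS mulr_sumr; apply: cylinder_split => h hS.
rewrite mulrA -prod_rcons -endpoint_rcons; apply: outer_leS (IH (rcons s h)).
by move=> w [cw Aw]; split=> // j jm; rewrite size_rcons addSnnS; exact: Aw.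
Qed.

(** For the empty word, the event lies in all the finite-horizon events, whose bounds tend to 0. *)
Lemma negligible_eventually (A : pred R) N :
  iter N T (stay S wt (@homeo_fun R) A n) x @[n --> \oo] --> 0 ->
  P.-negligible [set w | forall n, (N <= n)%N -> A (walk g x n w)].
Proof.
apply: negligible_outer_le => m; have := iter_stay_cylinder_le A N m [::].
rewrite big_nil mul1r; apply: outer_leS => w Aw; split=> // j _.
by apply: Aw; rewrite add0n leq_addr.
Qed.

End cylinders.

(** * Recurrence to the interval [[a, b]] *)

Lemma finite_set_nat_bounded (D : set nat) :
  finite_set D -> exists N, forall n, (N <= n)%N -> ~ D n.
Proof.
move=> fD; exists (\max_(i <- fset_set D) i).+1 => n Nn Dn.
have : n \in (fset_set D : seq nat) by rewrite in_fset_set// inE.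
by move=> nD; have := leq_bigmax_seq (F := id) n nD isT; rewrite leqNgt Nn.
Qed.

Theorem theorem4p3 (R : realType) (mu : probability (homeo R) R)
    (mu_irr : irreducible_measure mu) (mu_fin : finitely_supported mu)
    (mu_sym : symmetric_measure mu) :
  exists a b : R, a <= b /\
    forall (d : measure_display) (Omega : measurableType d)
           (P : probability Omega R) (g : nat -> {RV P >-> homeo R}),
      iid g mu ->
      forall x : R,
        {ae P, forall w, infinite_set [set n | walk g x n w \in `[a, b]]}.
Proof.
(* The initial value 0 of both folds gives [a <= 0 <= b], which the crossing argument uses. *)
pose b := \big[Num.max/0]_(h <- atoms mu) h 0.
pose a := \big[Num.min/0]_(h <- atoms mu) h 0.
have hb (h : homeo R) : h \in atoms mu -> h 0 <= b.
  by move=> hS; exact: (@Order.TotalTheory.le_bigmax_seq _ _ _ _ _ _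
    xpredT (fun k : homeo R => k 0) hS isT).
have ha (h : homeo R) : h \in atoms mu -> a <= h 0.
  by move=> hS; exact: (@Order.TotalTheory.ge_bigmin_seq _ _ _ _ _ _
    xpredT (fun k : homeo R => k 0) hS isT).
have b0 : 0 <= b by exact: bigmax_ge_id.
have a0 : a <= 0 by exact: bigmin_le_id.
exists a, b; split; first exact: le_trans b0.
move=> d Omega P g g_iid x.
have sys := symmetric_system_atoms mu_fin mu_sym mu_irr.
pose above N :=
  [set w | forall n, (N <= n)%N -> [pred z : R | b < z] (walk g x n w)].
pose below N :=
  [set w | forall n, (N <= n)%N -> [pred z : R | z < a] (walk g x n w)].
pose off := \bigcup_n (g n @^-1` (~` [set` atoms mu])).
have : P.-negligible (off `|` (\bigcup_N above N `|` \bigcup_N below N)).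
  apply: negligibleU; last apply: negligibleU; apply: negligible_bigcup => N.
  - exact: negligible_not_atom.
  - by apply: (negligible_eventually g_iid mu_fin);
      exact: (cvg_iter_stay_above sys).
  - by apply: (negligible_eventually g_iid mu_fin);
      exact: (cvg_iter_stay_below _ _ _ sys).
apply: negligibleS => w /= /contrapT /finite_set_nat_bounded[N outside].
have [[n _ gn]|on] := pselect (off w); first by left; exists n.
right.
have gS n : g n w \in atoms mu.
  by apply: contrapT => gn; apply: on; exists n.
have step n : walk g x n.+1 w = g n w (walk g x n w) by [].
have dich n : (N <= n)%N -> walk g x n w < a \/ b < walk g x n w.
  move=> /outside /negP; rewrite in_itv/= negb_and -!ltNge => /orP[]; by [left|right].
(* From time [N] on the walk keeps its side: an increment sends a point below [a <= 0] to a point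
   below [g n w 0 <= b], hence not above [b], and symmetrically from above. *)
have [lo|hi] := dich N (leqnn N).
  right; exists N => // n; elim: n => [|n IH] Nn /=.
    by move: Nn lo; rewrite leqn0 => /eqP->.
  have [NE|NE] := eqVneq N n.+1; first by rewrite -NE.
  have Nn' : (N <= n)%N by rewrite -ltnS ltn_neqAle NE.
  have [//|] := dich n.+1 Nn; rewrite step => bg.
  have := homeo_incr (g n w) (lt_le_trans (IH Nn') a0).
  by move=> /(lt_trans bg); rewrite ltNge hb.
left; exists N => // n; elim: n => [|n IH] Nn /=.
  by move: Nn hi; rewrite leqn0 => /eqP->.
have [NE|NE] := eqVneq N n.+1; first by rewrite -NE.
have Nn' : (N <= n)%N by rewrite -ltnS ltn_neqAle NE.
have [|//] := dich n.+1 Nn; rewrite step => ga.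
have := homeo_incr (g n w) (le_lt_trans b0 (IH Nn')).
by move=> /lt_trans/(_ ga); rewrite ltNge ha.
Qed.
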